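(* Let $\mu,\nu,\kappa\in\{0,1,2,\dots,\infty\}$. If linear relations $T:\mathbb V_{2\mu}\rightrightarrows\mathbb V_{2\nu}$ and $S:\mathbb V_{2\nu}\rightrightarrows\mathbb V_{2\kappa}$ are perfect Lagrangian, then their product $ST:\mathbb V_{2\mu}\rightrightarrows\mathbb V_{2\kappa}$ is perfect Lagrangian.
   Context: $\mathbb F$ is a finite field of characteristic $p>2$. For $n=0,1,2,\dots$, $V_n^d$ and $V_n^c$ are two copies of $\mathbb F^n$ (discrete topology). $V_\infty^d$ is the direct sum of countably many copies of $\mathbb F$ with the discrete topology; $V_\infty^c$ is the direct product of countably many copies of $\mathbb F$ with the product topology. For $\mu\in\{0,1,\dots,\infty\}$, $\mathbb V_{2\mu}:=V_\mu^d\oplus V_\mu^c$ (product of the topologies), with the symplectic form $\{(x,y),(x',y')\}=\sum_{j=1}^\mu(x_jy_j'-y_jx_j')$. A linear relation $T:X\rightrightarrows Y$ between $\mathbb F$-linear spaces is a linear subspace of $X\oplus Y$. The product of $T:X\rightrightarrows Y$ and $S:Y\rightrightarrows Z$ is $ST=\{(x,z)\in X\oplus Z:\ \exists y\in Y,\ (x,y)\in T,\ (y,z)\in S\}$. For $T:X\rightrightarrows Y$: $\ker T=T\cap(X\oplus 0)$; $\operatorname{dom}T$ is the projection of $T$ to $X$; $\operatorname{im}T$ is the projection of $T$ to $Y$; $\operatorname{indef}T=T\cap(0\oplus Y)$. $\ker T,\operatorname{dom}T$ are regarded as subspaces of $X$, and $\operatorname{im}T,\operatorname{indef}T$ as subspaces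 of $Y$. A subspace $Z\subset\mathbb V_{2\mu}$ is codiscrete if it is closed and the quotient $\mathbb V_{2\mu}/Z$ is discrete. Equip $\mathbb V_{2\mu}\oplus\mathbb V_{2\nu}$ with the form $\{(v,w),(v',w')\}=\{v,v'\}_{\mathbb V_{2\mu}}-\{w,w'\}_{\mathbb V_{2\nu}}$. A linear relation $T:\mathbb V_{2\mu}\rightrightarrows\mathbb V_{2\nu}$ is perfect Lagrangian if: (1) $T$ is a maximal isotropic subspace of $\mathbb V_{2\mu}\oplus\mathbb V_{2\nu}$ (in particular $T$ is closed); (2) $\ker T$ and $\operatorname{indef}T$ are compact; (3) $\operatorname{im}T$ and $\operatorname{dom}T$ are codiscrete. *)

(* Defs.v *)
From HB Require Import structures.
From mathcomp Require Import all_boot all_algebra.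
From mathcomp Require Import boolp classical_sets functions cardinality fsbigop.
From mathcomp Require Import topology.

Set Implicit Arguments.
Unset Strict Implicit.
Unset Printing Implicit Defensive.

Import GRing.Theory.

Local Open Scope classical_set_scope.
Local Open Scope ring_scope.

(* A linear subspace of X is an element of submodClosed X: a boolean predicate
   (decided classically if need be) closed under the module operations.  The
   library does not derive from it the additive subgroup structure that
   Quotient.quot needs. *)
Fact submod_zmod_closed (R : pzRingType) (X : lmodType R) (Z : submodClosed X) :
  zmod_closed Z.
Proof.
split=> [|x y Zx Zy]; first exact: (rpred0 Z).
by rewrite -scaleN1r; exact: (rpredD Zx (@rpredZ R X Z (-1) y Zy)).
Qed.
Definition submod_zmod (R : pzRingType) (X : lmodType R) (Z : submodClosed X) :
    zmodClosed X :=
  HB.pack_for (zmodClosed X) (Z : {pred X})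
    (GRing.isZmodClosed.Build X (Z : {pred X}) (@submod_zmod_closed R X Z)).

Section LinearRelations.
Context {F : fieldType}.
Implicit Types X Y Z : lmodType F.

Definition linrel X Y := submodClosed (X * Y)%type.

Definition lr_ker X Y (T : linrel X Y) : {pred X} := fun x => (x, 0) \in T.

Definition lr_indef X Y (T : linrel X Y) : {pred Y} := fun y => (0, y) \in T.

Definition lr_dom X Y (T : linrel X Y) : {pred X} :=
  fun x => `[< exists y, (x, y) \in T >].

Definition lr_im X Y (T : linrel X Y) : {pred Y} :=
  fun y => `[< exists x, (x, y) \in T >].

(* lr_comp S T is the product ST: first T, then S. *)
Definition lr_comp X Y Z (S : linrel Y Z) (T : linrel X Y) : {pred X * Z} :=
  fun u => `[< exists y, (u.1, y) \in T /\ (y, u.2) \in S >].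

Let linrelP X Y (T : linrel X Y) a x y x' y' :
  (x, y) \in T -> (x', y') \in T -> (a *: x + x', a *: y + y') \in T.
Proof. by move=> Tu Tv; have := @rpredD _ T _ _ (@rpredZ F _ T a _ Tu) Tv. Qed.

Fact lr_ker_submod X Y (T : linrel X Y) : submod_closed (lr_ker T).
Proof.
split=> [|a x x' Tx Tx']; first exact: (rpred0 T).
by have := linrelP a Tx Tx'; rewrite scaler0 addr0.
Qed.
HB.instance Definition _ X Y (T : linrel X Y) :=
  GRing.isSubmodClosed.Build F X (lr_ker T) (lr_ker_submod T).

Fact lr_indef_submod X Y (T : linrel X Y) : submod_closed (lr_indef T).
Proof.
split=> [|a y y' Ty Ty']; first exact: (rpred0 T).
by have := linrelP a Ty Ty'; rewrite scaler0 addr0.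
Qed.
HB.instance Definition _ X Y (T : linrel X Y) :=
  GRing.isSubmodClosed.Build F Y (lr_indef T) (lr_indef_submod T).

Fact lr_dom_submod X Y (T : linrel X Y) : submod_closed (lr_dom T).
Proof.
split=> [|a x x' /asboolP[y Txy] /asboolP[y' Txy']]; apply/asboolP.
  by exists 0; exact: (rpred0 T).
by exists (a *: y + y'); exact: linrelP.
Qed.
HB.instance Definition _ X Y (T : linrel X Y) :=
  GRing.isSubmodClosed.Build F X (lr_dom T) (lr_dom_submod T).

Fact lr_im_submod X Y (T : linrel X Y) : submod_closed (lr_im T).
Proof.
split=> [|a y y' /asboolP[x Txy] /asboolP[x' Txy']]; apply/asboolP.
  by exists 0; exact: (rpred0 T).
by exists (a *: x + x'); exact: linrelP.
Qed.
HB.instance Definition _ X Y (T : linrel X Y) :=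
  GRing.isSubmodClosed.Build F Y (lr_im T) (lr_im_submod T).

Fact lr_comp_submod X Y Z (S : linrel Y Z) (T : linrel X Y) :
  submod_closed (lr_comp S T).
Proof.
split=> [|a u v /asboolP[y [Ty Sy]] /asboolP[y' [Ty' Sy']]]; apply/asboolP.
  by exists 0; split; [exact: (rpred0 T)|exact: (rpred0 S)].
by exists (a *: y + y'); split; exact: linrelP.
Qed.
HB.instance Definition _ X Y Z (S : linrel Y Z) (T : linrel X Y) :=
  GRing.isSubmodClosed.Build F (X * Z)%type (lr_comp S T) (lr_comp_submod S T).

End LinearRelations.

(* The index mu in {0, 1, 2, ..., oo}. *)
Inductive enat := Fin of nat | Infty.

Definition idx (mu : enat) : choiceType :=
  match mu with Fin n => 'I_n | Infty => nat end.

Section Spaces.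
Variable (F : fieldType).

Definition finsupp (mu : enat) : {pred idx mu -> F^o} :=
  fun x => `[< finite_set [set j | x j != 0] >].

Fact finsupp_submod mu : submod_closed (@finsupp mu).
Proof.
split=> [|a x y /asboolP xfin /asboolP yfin]; apply/asboolP.
  by apply: sub_finite_set (finite_set0 _) => j /=; rewrite eqxx.
apply: (@sub_finite_set _ _ ([set j | x j != 0] `|` [set j | y j != 0])).
  move=> j /=; apply: contraNP => /not_orP[].
  move=> /negP/negPn/eqP xj /negP/negPn/eqP yj.
  by apply/eqP; rewrite [LHS](_ : _ = a * x j + y j)// xj yj mulr0 addr0.
by rewrite finite_setU.
Qed.
HB.instance Definition _ mu :=
  GRing.isSubmodClosed.Build F (idx mu -> F^o)
    (@finsupp mu) (@finsupp_submod mu).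

(* V_mu^d: direct sum of mu copies of F. *)
Record Vd (mu : enat) := MkVd {
  Vd_fun :> idx mu -> F^o;
  _ : Vd_fun \in @finsupp mu
}.

HB.instance Definition _ mu := [isSub for @Vd_fun mu].
HB.instance Definition _ mu := [Choice of Vd mu by <:].
HB.instance Definition _ mu := [SubChoice_isSubLmodule of Vd mu by <:].
HB.instance Definition _ mu := hasNbhs.Build (Vd mu) principal_filter.
HB.instance Definition _ mu := Discrete_ofNbhs.Build (Vd mu) erefl.

(* V_mu^c: direct product of mu copies of F; for finite mu the product topology
   is discrete, see Vc_fin_discrete. *)
Definition Vc (mu : enat) : Type :=
  prod_topology (fun _ : idx mu => discrete_topology F).

HB.instance Definition _ mu := GRing.Lmodule.copy (Vc mu) (idx mu -> F^o).
HB.instance Definition _ mu := Topological.copy (Vc mu)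
  (prod_topology (fun _ : idx mu => discrete_topology F)).

Definition V (mu : enat) : Type := (Vd mu * Vc mu)%type.

HB.instance Definition _ mu := GRing.Lmodule.copy (V mu) (Vd mu * Vc mu)%type.
HB.instance Definition _ mu := Topological.copy (V mu) (Vd mu * Vc mu)%type.

(* For fixed v and w only finitely many terms are nonzero, so the finitely
   supported sum is the sum over all indices j. *)
Definition sform (mu : enat) (v w : V mu) : F :=
  \sum_(j \in [set: idx mu]) (v.1 j * w.2 j - v.2 j * w.1 j).

Definition relform (mu nu : enat) (u u' : V mu * V nu) : F :=
  sform u.1 u'.1 - sform u.2 u'.2.

Definition isotropic (mu nu : enat) (T : linrel (V mu) (V nu)) : Prop :=
  {in T &, forall u u', relform u u' = 0}.

Definition maximal_isotropic (mu nu : enat) (T : linrel (V mu) (V nu)) : Prop :=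
  isotropic T /\
  forall L : linrel (V mu) (V nu),
    isotropic L -> {subset T <= L} -> {subset L <= T}.

Definition discrete_quotient (mu : enat) (Z : submodClosed (V mu)) : Prop :=
  forall A : set (quotient_topology (Quotient.quot (submod_zmod Z))), open A.

Definition codiscrete (mu : enat) (Z : submodClosed (V mu)) : Prop :=
  closed [set` Z] /\ discrete_quotient Z.

Definition perfect_lagrangian (mu nu : enat) (T : linrel (V mu) (V nu)) : Prop :=
  [/\ maximal_isotropic T,
      compact [set` lr_ker T] /\ compact [set` lr_indef T] &
      codiscrete (lr_im T) /\ codiscrete (lr_dom T)].

End Spaces.

Lemma Vc_fin_discrete (F : fieldType) (n : nat) (A : set (Vc F (Fin n))) : open A.
Proof.
pose K := fun _ : 'I_n => discrete_topology F.
rewrite openE => f Af; rewrite /interior.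
have nbhsf i : \forall g \near (f : prod_topology K), g i = f i.
  exact: (@proj_continuous _ K i f [set f i] (discrete_set1 _)).
have := filter_forall (nbhs_filter (f : prod_topology K)) nbhsf.
apply: filterS => g gf.
by rewrite (_ : g = f)//; apply: functional_extensionality_dep => i; exact: gf.
Qed.

(* Main.v *)
Require Import Defs.
From mathcomp Require Import all_boot all_algebra.
From HB Require Import structures.
From mathcomp Require Import boolp classical_sets functions cardinality fsbigop.
From mathcomp Require Import finmap filter topology.

(** A maximal isotropic relation is one that equals its own orthogonal
    ([maximal_isotropic_lagrangian]), a codiscrete subspace is an open one
    ([discrete_quotientP]), and for a Lagrangian relation
    [ker T = perp (dom T)] and [indef T = perp (im T)].  So [T] is perfect
    Lagrangian exactly when it is Lagrangian and has open domain and image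
    ([perfect_lagrangianP]); these are the properties to be established for the
    product [ST].

    The main tool is a duality statement, [perp_setI]: if the subspace [B] is
    open, then [perp (A `&` B)] is contained in [perp A + perp B].  A linear form
    given on [A] and vanishing on [A `&` B] extends to the whole space with value
    [0] on [B]; being zero on an open subspace it is continuous, hence given by
    pairing with a vector.  In particular open subspaces are biorthogonal
    ([perp_perp]).

    Self-orthogonality of [ST] ([lagrangian_rcomp]): if [(x, z)] is orthogonal to
    [ST], biorthogonality of [dom T] and [im S] provides [y1] and [y2] with
    [(x, y1)] in [T] and [(y2, z)] in [S], and [y1 - y2] is orthogonal to
    [im T `&` dom S].  By duality it splits along [indef T] and [ker S], and the
    two parts correct [y1] and [y2] to one common vector.

    Openness of [dom (ST)] ([nbhs_rdom_rcomp]): by the same duality, a vector of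
    [dom T] orthogonal to [ker (ST)] lies in [dom (ST)].  It remains to see that
    the vectors of [ker (ST)] have their discrete coordinates supported in one
    finite set ([finite_supp_ker_rcomp]).  As [dom T] is open, all but finitely
    many of these coordinates can be read on the middle vector, which ranges over
    the compact space [ker S `&` im T]; there each vector has finitely many
    nonzero coordinates, and a compactness argument makes this uniform
    ([uniform_vanishing]).  The image of [ST] is the domain of its transpose. *)

Set Implicit Arguments.
Unset Strict Implicit.
Unset Printing Implicit Defensive.

Import GRing.Theory.

Local Open Scope classical_set_scope.
Local Open Scope ring_scope.

(** * Linear forms with prescribed values on two subspaces *)

Section LinearSets.
Variables (F : fieldType) (E : lmodType F).
Implicit Types (A B L : set E) (v w : E).

Definition linear_set A := A 0 /\ forall a v w, A v -> A w -> A (a *: v + w).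

Lemma linear_setZ A a v : linear_set A -> A v -> A (a *: v).
Proof. by move=> [A0 Al] Av; rewrite -[_ *: _]addr0; apply: Al. Qed.

Lemma linear_setB A v w : linear_set A -> A v -> A w -> A (v - w).
Proof. by move=> [A0 Al] Av Aw; rewrite addrC -scaleN1r; apply: Al. Qed.

Lemma linear_extend A v : linear_set A ->
  linear_set [set w | exists a c, A a /\ w = a + c *: v].
Proof.
move=> [A0 Al]; split; first by exists 0, 0; rewrite scale0r addr0.
move=> k _ _ [a [c [Aa ->]]] [b [d [Ab ->]]].
exists (k *: a + b), (k * c + d); split; first exact: Al.
by rewrite scalerDr scalerA scalerDl addrACA.
Qed.

(** A subspace maximal among those that contain [B] and avoid [v] is a
    hyperplane complementary to [v], since adjoining any further vector [w]
    must capture [v]. *)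
Lemma maximal_avoiding B v : linear_set B -> ~ B v ->
  exists2 L, [/\ linear_set L, B `<=` L & ~ L v] &
    forall w, exists c, L (w - c *: v).
Proof.
move=> linB nBv.
(* Zorn's lemma is run on [B `|` X] rather than [X], so that the union of the
   empty chain qualifies as well. *)
pose P X := linear_set (B `|` X) /\ ~ (B `|` X) v.
have [|X [[linL nLv] Xmax]] := @Zorn_bigcup E P.
  move=> C CP Ctot.
  have [->|/set0P[X0 CX0]] := eqVneq C set0.
    by rewrite bigcup_set0 /P setU0.
  have inC w : (B `|` \bigcup_(X in C) X) w -> exists2 X, C X & (B `|` X) w.
    by move=> [Bw|[X CX Xw]]; [exists X0; [|left]|exists X; [|right]].
  have subC X : C X -> B `|` X `<=` B `|` \bigcup_(X in C) X.
    by move=> CX w [Bw|Xw]; [left|right; exists X].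
  split=> [|/inC[X /CP[]]//]; split=> [|a w1 w2 /inC[X1 CX1 w1X] /inC[X2 CX2 w2X]].
    by left; exact: linB.1.
  have [X12|X21] := Ctot _ _ CX1 CX2.
    apply: (subC _ CX2); have [[_ linX] _] := CP _ CX2.
    by apply: linX => //; apply: setUS w1X.
  apply: (subC _ CX1); have [[_ linX] _] := CP _ CX1.
  by apply: linX => //; apply: setUS w2X.
exists (B `|` X); first by split=> // w; left.
move=> w; have [Lw|nLw] := pselect ((B `|` X) w).
  by exists 0; rewrite scale0r subr0.
pose L' := [set u | exists a c, (B `|` X) a /\ u = a + c *: w].
have LL' : B `|` X `<=` L' by move=> u Lu; exists u, 0; rewrite scale0r addr0.
have L'w : L' w by exists 0, 1; rewrite scale1r add0r; split=> //; exact: linL.1.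
have /not_andP[] : ~ P L'.
- apply: Xmax; split; first by move=> u Xu; apply: LL'; right.
  by move=> L'X; apply: nLw; right; apply: L'X.
- have -> : B `|` L' = L' by apply/setUidPr => u Bu; apply: LL'; left.
  by move=> []; exact: linear_extend.
move=> /contrapT; have -> : B `|` L' = L'.
  by apply/setUidPr => u Bu; apply: LL'; left.
move=> [l [c [Ll vE]]].
have c0 : c != 0.
  by apply: contra_notN nLv => /eqP c0; rewrite vE c0 scale0r addr0.
exists c^-1; rewrite vE scalerDr scalerA mulVf// scale1r opprD addrC addrNK.
by rewrite -scalerN -scaleN1r scalerA; apply: linear_setZ.
Qed.

Definition linear_form (f : E -> F) :=
  forall a v w, f (a *: v + w) = a * f v + f w.

(** Gluing [g] on [A] with [0] on [B] is consistent because they agree on the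
    intersection.  If [g v0 = 1] with [v0] in [A], a hyperplane that contains
    both [B] and the zeros of [g] in [A] but not [v0] is the kernel of the form
    sought. *)
Lemma glue_linear_form A B (g : E -> F) :
    linear_set A -> linear_set B -> linear_form g ->
    (forall v, A v -> B v -> g v = 0) ->
  exists f, [/\ linear_form f, forall v, B v -> f v = 0 &
    forall v, A v -> f v = g v].
Proof.
move=> linA linB linG gAB.
have [[a0 [Aa0 ga0]]|gA] := pselect (exists v, A v /\ g v != 0); last first.
  exists (fun=> 0); split=> // [a v w|v Av]; first by rewrite mulr0 addr0.
  by apply/eqP; rewrite eq_sym; apply: contrapT => /negP gv; apply: gA; exists v.
pose v0 := (g a0)^-1 *: a0.
have gZ a v : g (a *: v) = a * g v.
  have g0 : g 0 = 0 by have := linG (-1) 0 0; rewrite scaler0 addr0 mulN1r addNr.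
  by rewrite -[_ *: _]addr0 linG g0 addr0.
have gv0 : g v0 = 1 by rewrite gZ mulVf.
have Av0 : A v0 by exact: linear_setZ.
pose C := [set w | exists b a, [/\ B b, A a, g a = 0 & w = b + a]].
have linC : linear_set C.
  split; first by exists 0, 0; rewrite addr0 -(scale0r v0) gZ mul0r; split=> //;
    rewrite ?scale0r; [exact: linB.1|exact: linA.1].
  move=> k _ _ [b [a [Bb Aa ga ->]]] [b' [a' [Bb' Aa' ga' ->]]].
  exists (k *: b + b'), (k *: a + a'); split; [exact: linB.2|exact: linA.2| |].
    by rewrite linG ga ga' mulr0 addr0.
  by rewrite scalerDr addrACA.
have nCv0 : ~ C v0.
  move=> [b [a [Bb Aa ga v0E]]].
  have bE : b = (- 1) *: a + v0 by rewrite v0E scaleN1r addrC addrK.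
  have := gAB b; rewrite {1 3}bE linG ga mulr0 add0r gv0 => /(_ _ Bb) b0.
  by have /eqP := b0 (linA.2 _ _ _ Aa Av0); rewrite oner_eq0.
have [L [linL CL nLv0] hyp] := maximal_avoiding linC nCv0.
have [f fP] := choice hyp.
have f_uniq v c : L (v - c *: v0) -> f v = c.
  move=> Lc; apply/eqP; rewrite -subr_eq0; apply: contra_notT nLv0 => fc0.
  have Ld := linear_setB linL Lc (fP v).
  rewrite -[v0]scale1r -(mulVf fc0) -scalerA; apply: linear_setZ => //.
  by move: Ld; rewrite opprB addrC addrA addrNK scalerBl.
have gL v : A v -> g v = 0 -> L v.
  by move=> Av gv; apply: CL; exists 0, v; rewrite add0r; split=> //; exact: linB.1.
exists f; split.
- move=> a v w; apply: f_uniq; rewrite scalerDl -scalerA opprD addrACA.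
  by rewrite -scalerBr; apply: linL.2.
- move=> v Bv; apply: f_uniq; rewrite scale0r subr0; apply: CL; exists v, 0.
  rewrite addr0; split=> //; first exact: linA.1.
  by rewrite -(scale0r v0) gZ mul0r.
- move=> v Av; apply: f_uniq; rewrite addrC -scaleNr; apply: gL.
    exact: linA.2.
  by rewrite linG gv0 mulr1 addNr.
Qed.

End LinearSets.

(** * The symplectic form in coordinates *)

Section Form.
Variables (F : fieldType) (mu : enat).
Implicit Types (v w : V F mu) (D : set (idx mu)).

(** The coordinates are retyped in [F] itself: in the definition of [V] they
    live in [F^o] and [discrete_topology F], whereas the computations below
    take place in the field. *)
Definition dcoord v j : F := v.1 j.
Definition ccoord v j : F := v.2 j.

Arguments dcoord : simpl never.
Arguments ccoord : simpl never.

Lemma dcoord_linear a v w j : dcoord (a *: v + w) j = a * dcoord v j + dcoord w j.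
Proof. by []. Qed.

Lemma ccoord_linear a v w j : ccoord (a *: v + w) j = a * ccoord v j + ccoord w j.
Proof. by []. Qed.

Lemma coord_ext v w : dcoord v =1 dcoord w -> ccoord v =1 ccoord w -> v = w.
Proof.
case: v w => [x y] [x' y'] /funext xx' /funext yy'.
by congr (_, _) => //; apply: val_inj.
Qed.

Definition supp v : set (idx mu) := [set j | dcoord v j != 0].

Lemma finite_supp v : finite_set (supp v).
Proof. by have /asboolP := valP v.1. Qed.

Lemma supp0 v j : ~ supp v j -> dcoord v j = 0.
Proof. by move=> /negP/negPn/eqP. Qed.

(** Every identity on the form is proved on a finite set of indices large
    enough for all the vectors involved. *)
Lemma sformE D v w : finite_set D -> supp v `<=` D -> supp w `<=` D ->
  sform v w = \sum_(j \in D) (dcoord v j * ccoord w j - dcoord w j * ccoord v j).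
Proof.
move=> Dfin vD wD.
rewrite (@fsbig_widen _ _ _ _ D setT)//; last first.
  move=> j [_ nDj] /=.
  rewrite (supp0 (contra_not (@vD j) nDj)) (supp0 (contra_not (@wD j) nDj)).
  by rewrite !mul0r subr0.
apply: eq_fsbigr => j _; congr (_ - _).
exact: (@mulrC F).
Qed.

Lemma sformC v w : sform v w = - sform w v.
Proof.
pose D := supp v `|` supp w.
have Dfin : finite_set D by rewrite finite_setU; split; exact: finite_supp.
have [vD wD] : supp v `<=` D /\ supp w `<=` D by split=> j; [left|right].
rewrite (sformE Dfin vD wD) (sformE Dfin wD vD) -mulN1r mulr_fsumr.
by apply: eq_fsbigr => j _; rewrite mulN1r opprB.
Qed.

Lemma sformPr a u v w : sform u (a *: v + w) = a * sform u v + sform u w.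
Proof.
pose D := supp u `|` (supp v `|` supp w).
have Dfin : finite_set D by rewrite !finite_setU; do !split; exact: finite_supp.
have [uD vD wD] : [/\ supp u `<=` D, supp v `<=` D & supp w `<=` D].
  by split=> j; [left|right; left|right; right].
have vwD : supp (a *: v + w) `<=` D.
  move=> j; apply: contraPP => nDj; apply/negP/negPn.
  have [jv jw] : ~ supp v j /\ ~ supp w j by split=> [/vD|/wD].
  by rewrite dcoord_linear (supp0 jv) (supp0 jw) mulr0 addr0.
rewrite (sformE Dfin uD vwD) (sformE Dfin uD vD) (sformE Dfin uD wD).
rewrite mulr_fsumr -fsbig_split//; apply: eq_fsbigr => j _.
rewrite dcoord_linear ccoord_linear /= mulrDr mulrBr mulrDl opprD addrACA.
by rewrite mulrCA !mulrA.
Qed.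

Lemma sformPl a v w u : sform (a *: v + w) u = a * sform v u + sform w u.
Proof. by rewrite sformC sformPr 2!(sformC u) mulrN opprD !opprK. Qed.

Lemma sformvv v : sform v v = 0.
Proof.
rewrite (sformE (finite_supp v))// fsbig1// => j _; exact: subrr.
Qed.

End Form.

Arguments dcoord : simpl never.
Arguments ccoord : simpl never.

(** * Neighbourhoods, and continuity of the form *)

Section Topology.
Variables (F : fieldType) (mu : enat).
Implicit Types (v w : V F mu) (D : set (idx mu)) (A : set (V F mu)).

Definition cylinder D v : set (V F mu) :=
  [set w | dcoord w =1 dcoord v /\ forall j, D j -> ccoord w j = ccoord v j].

Let cyl_filter (y : Vc F mu) : set_system (Vc F mu) :=
  [set B | exists2 D, finite_set D &
     [set z : Vc F mu | forall j, D j -> z j = y j] `<=` B].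

Lemma cyl_filter_filter y : Filter (cyl_filter y).
Proof.
split=> [|A B [D Df DA] [E Ef EB]|A B AB [D Df DA]].
- by exists set0.
- exists (D `|` E) => [|z zy]; first by rewrite finite_setU.
  by split; [apply: DA|apply: EB] => j ?; apply: zy; [left|right].
- by exists D => //; apply: subset_trans AB.
Qed.

(** The filter of cylinders converges to [y] in the product topology because it
    does so coordinatewise, which gives the nontrivial inclusion. *)
Lemma nbhs_Vc (y : Vc F mu) : nbhs y = cyl_filter y.
Proof.
have FF := cyl_filter_filter y.
apply/seteqP; split=> A.
  suff: cyl_filter y --> y by apply.
  apply/cvg_sup => i.
  have surj : (fun f : Vc F mu => f i) @` setT = setT by apply/seteqP; split.
  apply/cvg_image => //.
  move=> B /principal_filterP Byi.
  exists ((fun f : Vc F mu => f i) @^-1` B).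
    exists [set i] => // z zy /=; by rewrite zy.
  by rewrite image_preimage.
move=> [D Df DA]; apply: filterS DA _.
rewrite [X in nbhs y X](_ : _ = \bigcap_(j in D) [set z : Vc F mu | z j = y j])//.
have -> : D = [set` fset_set D] by rewrite fset_setK.
apply: filter_bigI => i _.
exact: (@proj_continuous _ (fun=> discrete_topology F) i y [set y i]
  (discrete_set1 _)).
Qed.

Lemma nbhs_V v A : nbhs v A <-> exists2 D, finite_set D & cylinder D v `<=` A.
Proof.
split.
  move=> [[/= B C] [/principal_filterP Bv]]; rewrite nbhs_Vc => -[D Df DC] BCA.
  exists D => // -[w1 w2] [w1v w2v]; apply: BCA; split => /=; last exact: DC.
  rewrite (_ : w1 = v.1)//; apply: val_inj; exact: funext.
move=> [D Df DA]; exists ([set v.1], [set y | forall j, D j -> y j = v.2 j]).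
  split=> /=; first exact/principal_filterP.
  by rewrite nbhs_Vc; exists D.
by move=> [w1 w2] [/= -> w2v]; apply: DA; split.
Qed.

Definition perp A : set (V F mu) := [set v | forall w, A w -> sform v w = 0].

Lemma sform0 v : sform v 0 = 0.
Proof.
have := sformPr (-1) v 0 0.
by rewrite scaler0 addr0 mulN1r addNr.
Qed.

(** Only the coordinates of [u] in the discrete part, and those of the compact
    part at the finitely many indices in [supp w], matter for [sform w u]. *)
Lemma sform_locally_constant w v : nbhs v [set u | sform w u = sform w v].
Proof.
apply/nbhs_V; exists (supp w); first exact: finite_supp.
move=> u [uv1 uv2] /=.
pose D := supp w `|` supp v.
have Dfin : finite_set D by rewrite finite_setU; split; exact: finite_supp.
have [wD vD] : supp w `<=` D /\ supp v `<=` D by split=> j; [left|right].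
have uD : supp u `<=` D by move=> j; rewrite /supp /= uv1 => /vD.
rewrite (sformE Dfin wD uD) (sformE Dfin wD vD); apply: eq_fsbigr => j _.
rewrite uv1; congr (_ - _).
have [/uv2->//|/supp0->] := pselect (supp w j); by rewrite !mul0r.
Qed.

Lemma closed_level w c : closed [set v | sform w v = c].
Proof.
by move=> v /(_ _ (sform_locally_constant w v))[u [/= <-]].
Qed.

Lemma closed_perp A : closed (perp A).
Proof.
rewrite (_ : perp A = \bigcap_(w in A) [set v | sform w v = 0]).
  by apply: closed_bigI => w _; exact: closed_level.
apply/seteqP; split=> v vA w Aw /=; first by rewrite sformC vA ?oppr0.
by rewrite sformC (vA w Aw) oppr0.
Qed.

Lemma nbhs_coset A v :
  linear_set A -> nbhs (0 : V F mu) A -> nbhs v [set w | A (w - v)].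
Proof.
move=> linA /nbhs_V[D Df DA]; apply/nbhs_V; exists D => // w [wv1 wv2]; apply: DA.
by split=> [j|j Dj]; rewrite addrC -scaleN1r ?dcoord_linear ?ccoord_linear
  ?wv1 ?wv2// mulN1r addNr.
Qed.

(** The preimage of a set of classes is a union of cosets of [Z], and each coset
    is a neighbourhood of its points by [nbhs_coset].  Conversely [Z] is the
    preimage of the class of [0]. *)
Lemma discrete_quotientP (Z : submodClosed (V F mu)) :
  discrete_quotient Z <-> nbhs (0 : V F mu) [set` Z].
Proof.
have linZ : linear_set [set` Z].
  split=> [|a v w Zv Zw] /=; first exact: rpred0.
  by apply: rpredD => //; apply: rpredZ.
have piP v w : (\pi_(Quotient.quot (submod_zmod Z)) v = \pi w)%qT <->
    v - w \in Z.
    by rewrite (rwP eqP) -Quotient.idealrBE.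
split=> [|Z0 A].
  move=> /(_ [set \pi_(Quotient.quot (submod_zmod Z))%qT 0]).
  rewrite /open/= /quotient_open openE => /(_ 0 erefl).
  rewrite /interior; apply: filterS => v /= /piP; by rewrite subr0.
rewrite /open/= /quotient_open openE => v Av; rewrite /interior.
apply: filterS (nbhs_coset v linZ Z0) => w /= /piP wv.
by rewrite wv.
Qed.

End Topology.

(** * Orthogonals of open subspaces are compact *)

Section Basis.
Variables (F : fieldType) (mu : enat).
Implicit Types (v w : V F mu) (D : set (idx mu)) (A : set (V F mu)).

Let delta (j : idx mu) : idx mu -> F^o := fun i => (i == j)%:R.

Lemma delta_finsupp j : delta j \in @Defs.finsupp F mu.
Proof.
apply/asboolP/(@sub_finite_set _ _ [set j]) => // i /=.
by apply: contraNP => /eqP/negPf ij; rewrite /delta ij.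
Qed.

Definition dvec j : V F mu := (MkVd (delta_finsupp j), 0).
Definition cvec j : V F mu := (0, delta j).

Lemma dcoord_dvec j i : dcoord (dvec j) i = (i == j)%:R. Proof. by []. Qed.

Lemma ccoord_dvec j i : ccoord (dvec j) i = 0. Proof. by []. Qed.

Lemma dcoord_cvec j i : dcoord (cvec j) i = 0. Proof. by []. Qed.

Lemma ccoord_cvec j i : ccoord (cvec j) i = (i == j)%:R. Proof. by []. Qed.

Lemma sform_cvec v j : sform v (cvec j) = dcoord v j.
Proof.
have cD : supp (cvec j) `<=` supp v by move=> i; rewrite /supp /= dcoord_cvec eqxx.
rewrite (sformE (finite_supp v) _ cD)//.
have [vj|vj] := pselect (supp v j).
  rewrite (fsbigD1 j)//=; last exact: finite_supp.
  rewrite fsbig1 => [|i [_ /eqP/negPf ij]].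
    by rewrite dcoord_cvec ccoord_cvec eqxx mulr1 mul0r subr0 addr0.
  by rewrite dcoord_cvec ccoord_cvec ij mulr0 mul0r subr0.
rewrite (supp0 vj) fsbig1// => i vi.
rewrite dcoord_cvec ccoord_cvec mul0r subr0.
case: eqP => [ij|_]; last by rewrite mulr0.
by case: vj; rewrite -ij.
Qed.

(** If [A] contains the cylinder on [D], it contains [cvec j] for every [j]
    outside [D], and pairing with [cvec j] reads off a discrete coordinate. *)
Lemma perp_nbhs_supp A : nbhs (0 : V F mu) A ->
  exists2 D, finite_set D & forall v, perp A v -> supp v `<=` D.
Proof.
move=> /nbhs_V[D Df DA]; exists D => // v vA j; apply: contraPP => nDj.
apply/negP/negPn; rewrite -sform_cvec vA//; apply: DA.
split=> // i Di; rewrite ccoord_cvec; case: eqP => // ij; by case: nDj; rewrite -ij.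
Qed.

End Basis.

(** The orthogonal is closed in the product of a finite set of discrete parts
    with the whole compact part.  Finiteness of the field is used twice: for
    that finite set and for Tychonoff's theorem. *)
Lemma compact_perp (F : finFieldType) mu (A : set (V F mu)) :
  nbhs (0 : V F mu) A -> compact (perp A).
Proof.
move=> /perp_nbhs_supp[D Df vD].
pose X := [set x : Vd F mu | forall j, ~ D j -> x j = 0].
apply: (@subclosed_compact _ _ (X `*` setT)); first exact: closed_perp.
  apply: compact_setX.
    apply: finite_compact.
    pose f (x : Vd F mu) :=
      if `[< X x >] then Some [ffun j : fset_set D => x (val j) : F] else None.
    rewrite (_ : X = f @^-1` [set~ None]); last first.
      by apply/seteqP; split=> x; rewrite /f /=; case: asboolP.
    apply: finite_preimage => // x y /set_mem + /set_mem; rewrite /f /=.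
    case: asboolP => // xX; case: asboolP => // yX _ _ [/ffunP xy].
    apply/val_inj/funext => j.
    have [Dj|nDj] := pselect (D j); last exact: etrans (xX _ nDj) (esym (yX _ nDj)).
    have jD : j \in fset_set D by rewrite in_fset_set//; apply/mem_set.
    by have := xy [` jD]%fset; rewrite !ffunE.
  have cF (j : idx mu) : compact [set: discrete_topology F].
    by apply: finite_compact; exact: (@finite_finset F).
  have := @tychonoff (idx mu) (fun=> discrete_topology F) (fun=> setT) cF.
  by congr compact; apply/seteqP; split.
by move=> v vA; split=> // j nDj; apply: supp0 => /(vD _ vA).
Qed.

(** * Duality between subspaces and their orthogonals *)

Section Duality.
Variables (F : fieldType) (mu : enat).
Implicit Types (v w : V F mu) (D : set (idx mu)) (A : set (V F mu)).

Lemma linear_form_sform w : linear_form (sform w).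
Proof. by move=> a v u; exact: sformPr. Qed.

Lemma sform_dvec v j : sform v (dvec F j) = - ccoord v j.
Proof.
have dD : supp (dvec F j) `<=` supp v `|` [set j].
  move=> i; rewrite /supp /= dcoord_dvec; case: (eqVneq i j) => [->|].
    by right.
  by rewrite eqxx.
have vD : supp v `<=` supp v `|` [set j] by move=> i; left.
have Df : finite_set (supp v `|` [set j]).
  by rewrite finite_setU; split=> //; exact: finite_supp.
rewrite (sformE Df vD dD) (fsbigD1 j)//=; last by right.
rewrite fsbig1 => [|i [_ /eqP/negPf ij]].
  by rewrite ccoord_dvec dcoord_dvec eqxx mulr0 mul1r sub0r addr0.
by rewrite ccoord_dvec dcoord_dvec ij mulr0 mul0r subr0.
Qed.

(** A vector becomes a member of the neighbourhood once finitely many of its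
    coordinates are cleared, and clearing them does not change the value. *)
Lemma linear_form_eq0 (f : V F mu -> F) A : linear_form f ->
    nbhs (0 : V F mu) A -> (forall v, A v -> f v = 0) ->
    (forall j, f (dvec F j) = 0) -> (forall j, f (cvec F j) = 0) ->
  forall v, f v = 0.
Proof.
move=> linf /nbhs_V[D Df DA] fA fd fc v.
have {DA}fD u : (forall j, dcoord u j = 0) -> (forall j, D j -> ccoord u j = 0) ->
    f u = 0.
  by move=> u1 u2; apply/fA/DA.
have [s] : exists s : seq (idx mu),
    forall j, j \notin s -> dcoord v j = 0 /\ (D j -> ccoord v j = 0).
  exists (fset_set (D `|` supp v)) => j; have Evf : finite_set (D `|` supp v).
    by rewrite finite_setU; split=> //; exact: finite_supp.
  rewrite in_fset_set// notin_setE => /not_orP[nDj nvj]; split=> //.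
  exact: supp0.
elim: s v => [|i s IHs] v vs.
  by apply: fD => j; have [] := vs j isT.
pose u := (- ccoord v i) *: cvec F i + ((- dcoord v i) *: dvec F i + v).
have <- : f u = f v by rewrite !linf fd fc !mulr0 !add0r.
apply: IHs => j js; rewrite /u !dcoord_linear !ccoord_linear.
rewrite dcoord_dvec dcoord_cvec ccoord_dvec ccoord_cvec.
have [->|ji] := eqVneq j i.
  by rewrite !mulr1 !mulr0 !add0r !addNr.
rewrite !mulr0 !add0r; apply: vs.
by rewrite inE (negPf ji).
Qed.

(** The discrete coordinates of the representing vector are the values of [f] on
    the [cvec j]; they are finitely many because [f] vanishes on a
    neighbourhood of [0]. *)
Lemma linear_form_representable (f : V F mu -> F) A :
    linear_form f -> nbhs (0 : V F mu) A ->
  (forall v, A v -> f v = 0) -> exists w, f =1 sform w.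
Proof.
move=> linf A0 fA; have /nbhs_V[D Df DA] := A0.
have w1fin : (fun j => f (cvec F j) : F^o) \in @Defs.finsupp F mu.
  apply/asboolP/(sub_finite_set _ Df) => j /=; apply: contraPP => nDj.
  apply/negP/negPn/eqP/fA/DA; split=> // i Di.
  by rewrite ccoord_cvec; case: eqP => // ij; case: nDj; rewrite -ij.
pose w : V F mu := (MkVd w1fin, fun j => - f (dvec F j)).
exists w => v; apply/eqP; rewrite -subr_eq0.
pose g v := f v - sform w v.
have linG : linear_form g.
  by move=> a x y; rewrite /g linf sformPr mulrBr opprD addrACA.
apply/eqP/(@linear_form_eq0 g (A `&` [set u | sform w u = 0])) => //.
- apply: filterI => //.
  by have := sform_locally_constant w 0; rewrite sform0.
- by move=> u [Au wu]; rewrite /g fA// wu subr0.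
- by move=> j; rewrite /g sform_dvec opprK; exact: addrN.
- by move=> j; rewrite /g sform_cvec; exact: addrN.
Qed.

(** The form equal to [sform u] on [A] and to [0] on [B] is continuous, as it
    vanishes on the open subspace [B], hence is represented by a vector [w].
    The sum [perp A + perp B] itself is reached, not only its closure: the
    middle vectors of a composite are found this way. *)
Lemma perp_setI A B u : linear_set A -> linear_set B -> nbhs (0 : V F mu) B ->
  perp (A `&` B) u -> exists2 w, perp B w & perp A (u - w).
Proof.
move=> linA linB B0 uAB.
have [f [linf fB fA]] : exists f, [/\ linear_form f, forall v, B v -> f v = 0 &
    forall v, A v -> f v = sform u v].
  apply: glue_linear_form => // [|v Av Bv]; first exact: linear_form_sform.
  exact: uAB.
have [w fE] := linear_form_representable linf B0 fB.
exists w => v Bv; first by rewrite -fE fB.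
rewrite sformC -scaleN1r addrC sformPr sformC (sformC v) -!fE fA// mulN1r.
by rewrite opprK addrN oppr0.
Qed.

Lemma sform_nondegenerate v : (forall w, sform w v = 0) -> v = 0.
Proof.
move=> v0; apply: coord_ext => j.
  by rewrite -sform_cvec sformC v0 oppr0.
by apply/oppr_inj; rewrite -sform_dvec sformC v0.
Qed.

(** For [v] outside [A], the line through [v] meets [A] in [0], so that
    [perp_setI] moves any [u] with [sform u v != 0] into [perp A] without
    changing its value at [v]. *)
Lemma perp_perp A : linear_set A -> nbhs (0 : V F mu) A -> perp (perp A) `<=` A.
Proof.
move=> linA A0 v vA; apply: contrapT => nAv.
pose L := [set w | exists a c, [set (0 : V F mu)] a /\ w = a + c *: v].
have linL : linear_set L.
  apply: linear_extend; split=> // a x y -> ->; by rewrite scaler0 addr0.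
have [u uv] : exists u, sform u v != 0.
  apply: contrapT => v0; apply: nAv; rewrite (_ : v = 0); first exact: linA.1.
  apply: sform_nondegenerate => w; apply/eqP; apply: contrapT => /negP wv.
  by apply: v0; exists w.
have [|w wA uw] := perp_setI linL linA A0 (u := u).
  move=> _ [[_ [c [-> ->]]]]; rewrite add0r => Acv.
  have [->|c0] := eqVneq c 0; first by rewrite scale0r sform0.
  case: nAv; rewrite -(scale1r v) -(mulVf c0) -scalerA; exact: linear_setZ.
have Lv : L v by exists 0, 1; rewrite scale1r add0r.
have := uw v Lv; rewrite sformC -scaleN1r addrC sformPr (vA w wA) mulr0 add0r.
by rewrite -sformC => /eqP; rewrite (negPf uv).
Qed.

Lemma closed_nbhs A : linear_set A -> nbhs (0 : V F mu) A -> closed A.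
Proof.
move=> linA A0; rewrite (_ : A = perp (perp A)); first exact: closed_perp.
apply/seteqP; split; last exact: perp_perp.
by move=> v Av w wA; rewrite sformC wA ?oppr0.
Qed.

End Duality.

(** * Uniformly finite supports over a compact subspace *)

Section Uniform.
Variables (F : fieldType) (nu : enat).
Implicit Types (v w : V F nu).

(** A substitute for the Baire category theorem.  The vectors
    [(sform (w n) y)_n], for [y] in [K], are finitely supported; if their
    supports are not uniformly bounded then infinitely many [n] are leading
    positions, that is positions of a last nonzero entry.  Elimination in
    echelon form gives [y_m] in [K] whose entries at the leading positions
    below [m] are all [1].  A cluster point of the [y_m] has entry [1] at every
    leading position, so its support is infinite. *)
Lemma uniform_vanishing (w : nat -> V F nu) (K : set (V F nu)) :
    linear_set K -> compact K ->
    (forall y, K y -> exists N, forall n, (N <= n)%N -> sform (w n) y = 0) ->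
  exists N, forall y, K y -> forall n, (N <= n)%N -> sform (w n) y = 0.
Proof.
move=> linK cptK Kfin; apply: contrapT => /forallNP nK.
pose lead n := exists q, [/\ K q, sform (w n) q = 1 &
  forall m, (n < m)%N -> sform (w m) q = 0].
have leadN N : exists2 n, (N <= n)%N & lead n.
  have [y [n [Ky Nn yn]]] : exists y n, [/\ K y, (N <= n)%N & sform (w n) y != 0].
    apply: contrapT => H; apply: (nK N) => y Ky n Nn; apply/eqP.
    by apply: contrapT => /negP yn; apply: H; exists y, n.
  have [M yM] := Kfin y Ky.
  have bdd i : sform (w i) y != 0 -> (i <= M)%N.
    by apply: contra_neqT; rewrite -ltnNge => /ltnW /yM.
  have [m my mmax] := ex_maxnP (ex_intro (fun i => sform (w i) y != 0) n yn) bdd.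
  exists m; first exact: leq_trans (mmax _ yn).
  exists ((sform (w m) y)^-1 *: y); split; first exact: linear_setZ.
    by rewrite -[_ *: _]addr0 sformPr sform0 addr0 mulVf.
  move=> i mi; rewrite -[_ *: _]addr0 sformPr sform0 addr0.
  have /eqP -> : sform (w i) y == 0; last by rewrite mulr0.
  by apply: contraTT mi => /mmax; rewrite -leqNgt.
(* The vanishing from [m] on is carried along so that the next leading vector
   [q] is the only one contributing at position [m]. *)
have interp m : forall t : nat -> F, exists y, [/\ K y,
    forall n, (m <= n)%N -> sform (w n) y = 0 &
    forall n, (n < m)%N -> lead n -> sform (w n) y = t n].
  elim: m => [|m IHm] t.
    by exists 0; split=> // [|n _]; [exact: linK.1|exact: sform0].
  have [[q [Kq qm q0]]|nm] := pselect (lead m).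
    have [y [Ky y0 yt]] := IHm (fun n => t n - t m * sform (w n) q).
    exists (t m *: q + y); split; first exact: linK.2.
      by move=> n mn; rewrite sformPr q0// y0 ?mulr0 ?addr0// ltnW.
    move=> n; rewrite ltnS leq_eqVlt sformPr => /predU1P[-> _|nm /yt->//].
      by rewrite qm y0// mulr1 addr0.
    by rewrite addrC addrNK.
  have [y [Ky y0 yt]] := IHm t; exists y; split=> // n.
    by move=> /ltnW /y0.
  by rewrite ltnS leq_eqVlt => /predU1P[->//|]; exact: yt.
have [y yP] := choice (fun m => interp m (fun=> 1)).
have [|p [Kp py]] := cptK (y @ \oo) _.
  by exists 0%N => // m _; have [] := yP m.
have [N pN] := Kfin p Kp; have [n Nn nL] := leadN N.
have [|u [[m /= nm <-]]] := py (y @` [set m | (n < m)%N]) _ _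
    (sform_locally_constant (w n) p).
  by exists n.+1 => // m /= nm; exists m.
have [_ _ /(_ n nm nL) ->] := yP m.
by rewrite /= pN// => /eqP; rewrite oner_eq0.
Qed.

Lemma uniform_vanishing_idx mu (w : idx mu -> V F nu) (K : set (V F nu)) :
    linear_set K -> compact K ->
    (forall y, K y -> finite_set [set j | sform (w j) y != 0]) ->
  exists2 D, finite_set D & forall y, K y -> forall j, ~ D j -> sform (w j) y = 0.
Proof.
case: mu w => [n|] w linK cptK Kfin.
  by exists setT => [|? _ ? []//]; exact: (@finite_finset 'I_n).
have [y Ky|N KN] := @uniform_vanishing w K linK cptK.
  have yf := Kfin y Ky.
  exists (\max_(i <- fset_set [set j | sform (w j) y != 0]) i).+1 => n nN.
  apply/eqP; apply: contraTT nN => yn; rewrite -leqNgt.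
  by rewrite (@leq_bigmax_seq _ _ xpredT id)// in_fset_set//; exact: mem_set.
exists `I_N; first exact: finite_II.
by move=> y Ky j /negP; rewrite -leqNgt; exact: KN.
Qed.

End Uniform.

(** * Lagrangian relations and their composition *)

Section Lagrangian.
Variables (F : fieldType) (mu nu : enat).
Implicit Type T : V F mu -> V F nu -> Prop.

(** Equality of a relation with its own orthogonal for the difference of the two
    forms.  Linearity is a consequence, so that transposition and composition
    can be handled on bare relations. *)
Definition lagrangian T := forall x y,
  T x y <-> forall a b, T a b -> sform x a = sform y b.

Definition rdom T : set (V F mu) := [set x | exists y, T x y].
Definition rim T : set (V F nu) := [set y | exists x, T x y].

Lemma lagrangian_linear T a x y x' y' : lagrangian T ->
  T x y -> T x' y' -> T (a *: x + x') (a *: y + y').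
Proof.
move=> lT /lT Txy /lT Txy'; apply/lT => c d Tcd.
rewrite sformC sformPr (sformC (_ + _)) sformPr 2!(sformC c) 2!(sformC d).
by rewrite (Txy c d Tcd) (Txy' c d Tcd).
Qed.

Lemma lagrangian0 T : lagrangian T -> T 0 0.
Proof. by move=> lT; apply/lT => a b _; rewrite sformC (sformC 0) !sform0. Qed.

Lemma lagrangianB T x y x' y' : lagrangian T ->
  T x y -> T x' y' -> T (x - x') (y - y').
Proof.
move=> lT Txy Txy'; rewrite ![_ - _]addrC -!scaleN1r; exact: lagrangian_linear.
Qed.

Lemma linear_rdom T : lagrangian T -> linear_set (rdom T).
Proof.
move=> lT; split; first by exists 0; exact: lagrangian0.
by move=> a x x' [y Txy] [y' Txy']; exists (a *: y + y'); exact: lagrangian_linear.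
Qed.

Lemma linear_ker T : lagrangian T -> linear_set [set x | T x 0].
Proof.
move=> lT; split; first exact: lagrangian0.
move=> a x x' Tx Tx'.
by have := lagrangian_linear a lT Tx Tx'; rewrite scaler0 addr0.
Qed.

Lemma kerE T x : lagrangian T -> T x 0 <-> perp (rdom T) x.
Proof.
move=> lT; split=> [/lT Tx a [b /Tx ->]|xT]; first by rewrite sformC sform0 oppr0.
by apply/lT => a b Tab; rewrite xT ?[RHS]sformC ?sform0 ?oppr0//; exists b.
Qed.

End Lagrangian.

Definition transpose (F : fieldType) mu nu (T : V F mu -> V F nu -> Prop) y x :=
  T x y.

Lemma lagrangian_transpose (F : fieldType) mu nu (T : V F mu -> V F nu -> Prop) :
  lagrangian T -> lagrangian (transpose T).
Proof.
move=> lT y x; split=> [/lT Txy b a Tab|Txy]; first by rewrite (Txy a b Tab).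
by apply/lT => a b Tab; rewrite (Txy b a Tab).
Qed.

Lemma indefE (F : fieldType) mu nu (T : V F mu -> V F nu -> Prop) y :
  lagrangian T -> T 0 y <-> perp (rim T) y.
Proof. by move=> lT; exact: (kerE y (lagrangian_transpose lT)). Qed.

Lemma linear_rim (F : fieldType) mu nu (T : V F mu -> V F nu -> Prop) :
  lagrangian T -> linear_set (rim T).
Proof. by move=> lT; exact: (linear_rdom (lagrangian_transpose lT)). Qed.

Section Composition.
Variables (F : fieldType) (mu nu kappa : enat).
Variables (T : V F mu -> V F nu -> Prop) (S : V F nu -> V F kappa -> Prop).
Hypotheses (lT : lagrangian T) (lS : lagrangian S).
Hypotheses (domT : nbhs (0 : V F mu) (rdom T)) (imT : nbhs (0 : V F nu) (rim T)).
Hypotheses (domS : nbhs (0 : V F nu) (rdom S)) (imS : nbhs (0 : V F kappa) (rim S)).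

Definition rcomp (x : V F mu) (z : V F kappa) := exists y, T x y /\ S y z.

(** Let [(x, z)] be orthogonal to the composite.  Orthogonality to [ker T] and
    to [indef S] puts [x] in [rdom T] and [z] in [rim S], as these are
    biorthogonal; let [y1] and [y2] be corresponding middle vectors.  Then
    [y1 - y2] is orthogonal to the intersection of [rim T] and [rdom S], hence
    splits by [perp_setI] into a vector of [ker S] and one of [indef T], which
    correct [y2] and [y1] to a common middle vector. *)
Lemma lagrangian_rcomp : lagrangian rcomp.
Proof.
move=> x z; split=> [[y [/lT Txy /lS Syz]] a c [b [Tab Sbc]]|xz].
  by rewrite (Txy a b)// (Syz b c).
have [y1 Txy1] : rdom T x.
  apply: (perp_perp (linear_rdom lT) domT) => a /(kerE _ lT) Ta.
  rewrite (xz a 0); first exact: sform0.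
  by exists 0; split=> //; exact: lagrangian0.
have [y2 Sy2z] : rim S z.
  apply: (perp_perp (linear_rim lS) imS) => c /(indefE _ lS) Sc.
  rewrite -(xz 0 c); first exact: sform0.
  by exists 0; split=> //; exact: lagrangian0.
have [|w /(kerE _ lS) Sw /(indefE _ lT) Tw] :=
    perp_setI (linear_rim lT) (linear_rdom lS) domS (u := y1 - y2).
  move=> b [[a Tab] [c Sbc]]; rewrite sformC -scaleN1r addrC sformPr mulN1r.
  have /lT/(_ _ _ Tab) y1b := Txy1; have /lS/(_ _ _ Sbc) y2b := Sy2z.
  rewrite (sformC b y2) (sformC b y1) -y1b y2b (xz a c) ?opprK ?subrr ?oppr0//.
  by exists b.
exists (y2 + w); split.
  have := lagrangianB lT Txy1 Tw; rewrite subr0.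
  by rewrite opprB opprB addrC addrA addrNK addrC.
by have := lagrangian_linear 1 lS Sw Sy2z; rewrite !scale1r add0r addrC.
Qed.

Hypothesis compact_kerS : compact [set y | S y 0].

(** The discrete coordinate of [x] at [j] is [sform x (cvec F j)].  For almost
    all [j] the vector [cvec F j] lies in [rdom T], and [T] transports this value
    to the pairing of the middle vector [y] with a fixed [v j].  As [y] ranges
    over the compact subspace [ker S `&` rim T], [uniform_vanishing_idx]
    applies. *)
Lemma finite_supp_ker_rcomp :
  exists2 D : set (idx mu), finite_set D & forall x, rcomp x 0 -> supp x `<=` D.
Proof.
have /nbhs_V[D0 D0f D0T] := domT.
have vP j : exists v, ~ D0 j -> T (cvec F j) v.
  have [D0j|nD0j] := pselect (D0 j); first by exists 0.
  suff [v Tv] : rdom T (cvec F j) by exists v.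
  apply: D0T; split=> // i D0i; rewrite ccoord_cvec.
  by case: eqP => // ij; case: nD0j; rewrite -ij.
have [v Tv] := choice vP.
(* The finitely many indices in [D0], at which [cvec F j] may lie outside
   [rdom T], are silenced. *)
pose w j := if `[< D0 j >] then 0 else v j.
have wE x y j : T x y -> ~ D0 j -> sform (w j) y = - dcoord x j.
  move=> Txy nD0j; rewrite /w asboolF// sformC -sform_cvec; congr (- _).
  by have /lT/(_ _ _ (Tv j nD0j)) := Txy.
have w0 y j : D0 j -> sform (w j) y = 0.
  by move=> D0j; rewrite /w asboolT// sformC sform0 oppr0.
pose K := [set y | S y 0] `&` rim T.
have cptK : compact K.
  exact: compact_closedI (closed_nbhs (linear_rim lT) imT).
have linK : linear_set K.
  split; first by split; [exact: lagrangian0|exact: (linear_rim lT).1].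
  move=> a y y' [Sy Ty] [Sy' Ty'].
  by split; [exact: (linear_ker lS).2|exact: (linear_rim lT).2].
have [|D1 D1f D1w] := uniform_vanishing_idx (w := w) linK cptK.
  move=> y [_ [x Txy]]; apply: sub_finite_set (finite_supp x) => j /=.
  have [D0j|nD0j] := pselect (D0 j); first by rewrite w0// eqxx.
  by rewrite (wE x)// oppr_eq0.
exists (D0 `|` D1); first by rewrite finite_setU.
move=> x [y [Txy Sy]] j xj; apply: contrapT => /not_orP[nD0j nD1j].
move: xj; rewrite /supp /= -oppr_eq0 -(wE x y)// D1w ?eqxx//.
by split=> //; exists x.
Qed.

(** A vector [x] close to [0] lies in [rdom T] and is orthogonal to the kernel of
    the composite.  Its middle vector [y] is then orthogonal to
    [ker S `&` rim T], so that a change of [y] by [indef T = perp (rim T)] makes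
    it orthogonal to [ker S], that is brings it into [rdom S]. *)
Lemma nbhs_rdom_rcomp : nbhs (0 : V F mu) (rdom rcomp).
Proof.
have /nbhs_V[D0 D0f D0T] := domT; have [D1 D1f kerD1] := finite_supp_ker_rcomp.
apply/nbhs_V; exists (D0 `|` D1); first by rewrite finite_setU.
move=> x [x1 x2].
have [y Txy] : rdom T x by apply: D0T; split=> // j D0j; apply: x2; left.
have [|w wT wS] := perp_setI (linear_ker lS) (linear_rim lT) imT (u := y).
  move=> b [Sb [a Tab]]; have /lT/(_ _ _ Tab) <- := Txy.
  have xD1 : supp x `<=` D1 by move=> j; rewrite /supp /= x1 eqxx.
  have aD1 : supp a `<=` D1 by apply: kerD1; exists b.
  rewrite (sformE D1f xD1 aD1) fsbig1// => j D1j.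
  by rewrite x1 x2 ?mulr0 ?mul0r ?subr0//; right.
have [z Sz] : rdom S (y - w).
  apply: (perp_perp (linear_rdom lS) domS) => b /(kerE _ lS) Sb; exact: wS.
exists z, (y - w); split=> //.
by have := lagrangianB lT Txy ((indefE _ lT).2 wT); rewrite subr0.
Qed.

End Composition.

(** * Perfect Lagrangian relations *)

Section Packaged.
Variables (F : fieldType) (mu nu : enat).
Implicit Type T : linrel (V F mu) (V F nu).

Definition rel_of T : V F mu -> V F nu -> Prop := fun x y => (x, y) \in T.

Lemma lagrangian_maximal_isotropic T :
  lagrangian (rel_of T) -> maximal_isotropic T.
Proof.
move=> lT; split=> [[x y] [x' y'] Txy Txy'|L isoL TL [x y] Lxy].
  by apply/eqP; rewrite subr_eq0; apply/eqP; have /lT := Txy; apply.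
apply/lT => a b /TL Lab; apply/eqP; rewrite -subr_eq0; apply/eqP.
exact: (isoL (x, y) (a, b)).
Qed.

(** Adjoining to [T] a vector orthogonal to it keeps it isotropic, because the
    form is alternating. *)
Lemma maximal_isotropic_lagrangian T :
  maximal_isotropic T -> lagrangian (rel_of T).
Proof.
move=> [isoT maxT] x y; split=> [Txy a b Tab|Txy].
  by apply/eqP; rewrite -subr_eq0; apply/eqP/(isoT (x, y) (a, b)).
pose L : {pred V F mu * V F nu} :=
  fun u => `[< exists a c, a \in T /\ u = a + c *: (x, y) >].
have linT : linear_set [set` T].
  split=> [|a v w Tv Tw] /=; first exact: rpred0.
  by apply: rpredD => //; apply: rpredZ.
have Lsub : submod_closed L.
  have [L0 Ll] := linear_extend (x, y) linT.
  split; first exact/asboolP.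
  by move=> a u v /asboolP Lu /asboolP Lv; apply/asboolP/Ll.
pose L' : linrel (V F mu) (V F nu) :=
  HB.pack_for (submodClosed (V F mu * V F nu)%type) L
  (GRing.isSubmodClosed.Build F (V F mu * V F nu)%type L Lsub).
apply: (maxT L'); last first.
- by apply/asboolP; exists 0, 1; rewrite scale1r add0r; split=> //; exact: rpred0.
- by move=> u Tu; apply/asboolP; exists u, 0; rewrite scale0r addr0.
move=> _ _ /asboolP[[a b] [c [Tab ->]]] /asboolP[[a' b'] [c' [Tab' ->]]].
rewrite /relform /=.
have aa' : sform a a' = sform b b'.
  by apply/eqP; rewrite -subr_eq0; apply/eqP/(isoT (a, b) (a', b')).
rewrite (addrC a) (addrC a') (addrC b) (addrC b') !sformPl !sformPr !sformvv aa'.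
by rewrite (Txy _ _ Tab') (sformC a x) (sformC b y) (Txy _ _ Tab) subrr.
Qed.

End Packaged.

(** For a Lagrangian relation the kernel and the indefiniteness are the
    orthogonals of the domain and of the image; the compactness conditions thus
    follow from the openness ones. *)
Lemma perfect_lagrangianP (F : finFieldType) (mu nu : enat)
    (T : linrel (V F mu) (V F nu)) :
  perfect_lagrangian T <->
  [/\ lagrangian (rel_of T), nbhs (0 : V F mu) (rdom (rel_of T)) &
      nbhs (0 : V F nu) (rim (rel_of T))].
Proof.
have domE : [set` lr_dom T] = rdom (rel_of T).
  by apply/seteqP; split=> x /asboolP.
have imE : [set` lr_im T] = rim (rel_of T).
  by apply/seteqP; split=> x /asboolP.
split=> [[/maximal_isotropic_lagrangian lT _ [[_ imT] [_ domT]]]|[lT domT imT]].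
  split=> //; first by rewrite -domE; exact/discrete_quotientP.
  by rewrite -imE; exact/discrete_quotientP.
split; first exact: lagrangian_maximal_isotropic.
- split.
  + rewrite (_ : [set` _] = perp (rdom (rel_of T))); first exact: compact_perp.
    by apply/seteqP; split=> x /(kerE _ lT).
  + rewrite (_ : [set` _] = perp (rim (rel_of T))); first exact: compact_perp.
    by apply/seteqP; split=> x /(indefE _ lT).
- split; split.
  + by rewrite imE; apply: closed_nbhs => //; exact: linear_rim.
  + by apply/discrete_quotientP; rewrite imE.
  + by rewrite domE; apply: closed_nbhs => //; exact: linear_rdom.
  + by apply/discrete_quotientP; rewrite domE.
Qed.

Theorem theorem1p4 (F : finFieldType) (p : nat) (hp : p \in [pchar F])
    (hp2 : (2 < p)%N) (mu nu kappa : enat)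
    (T : linrel (V F mu) (V F nu)) (S : linrel (V F nu) (V F kappa))
    (hT : perfect_lagrangian T) (hS : perfect_lagrangian S) :
  perfect_lagrangian (lr_comp S T).
Proof.
have [lT domT imT] := (perfect_lagrangianP T).1 hT.
have [lS domS imS] := (perfect_lagrangianP S).1 hS.
have RE : rel_of (lr_comp S T) = rcomp (rel_of T) (rel_of S).
  by apply/funext => x; apply/funext => z; apply/propext; split=> /asboolP.
have RtE : transpose (rcomp (rel_of T) (rel_of S)) =
    rcomp (transpose (rel_of S)) (transpose (rel_of T)).
  apply/funext => z; apply/funext => x; apply/propext.
  by split=> -[y []]; exists y.
have [_ [kerS _] _] := hS; have [_ [_ indefT] _] := hT.
apply/perfect_lagrangianP; rewrite RE; split.
- exact: lagrangian_rcomp.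
- exact: nbhs_rdom_rcomp.
- change (nbhs (0 : V F kappa) (rdom (transpose (rcomp (rel_of T) (rel_of S))))).
  by rewrite RtE; apply: nbhs_rdom_rcomp => //; exact: lagrangian_transpose.
Qed.
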